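(* Let $n \geq 3$. Let $G \colon \mathbf{Cstar}^{\mathrm{op}} \to \mathbf{Loc}$ be any functor that assigns to each commutative C*-algebra its Gelfand spectrum, i.e. the restriction of $G$ to $\mathbf{cCstar}^{\mathrm{op}}$ is the Gelfand spectrum functor $\mathrm{Spec} \colon \mathbf{cCstar}^{\mathrm{op}} \to \mathbf{Loc}$ (up to natural isomorphism). Then $G$ trivializes on the C*-algebra $\mathbb{M}_n(\mathbb{C})$ of $n$-by-$n$ complex matrices: $G(\mathbb{M}_n(\mathbb{C}))$ is an initial object of $\mathbf{Loc}$, that is, isomorphic to the locale of opens of the empty topological space.
   Context: All C*-algebras are unital (the zero algebra, in which $0=1$, is allowed). $\mathbf{Cstar}$ is the category of C*-algebras and unital $*$-homomorphisms, and $\mathbf{cCstar}$ is its full subcategory of commutative C*-algebras. A locale is a complete lattice $L$ satisfying $\bigvee_i (x \wedge y_i) = x \wedge \bigvee_i y_i$. A morphism of locales $K \to L$ is a function $f \colon L \to K$ (note the direction) preserving finite meets (including the top element) and arbitrary joins. These form the category $\mathbf{Loc}$. Its initial object is the one-element lattice. The Gelfand spectrum of a commutative C*-algebra $A$ is the (compact regular) locale $\mathrm{Spec}(A)$ whose opens are the closed ideals of $A$ ordered by inclusion; equivalently, it is the locale of open sets of the compact Hausdorff space of characters (unital $*$-homomorphisms $A \to \mathbb{C}$) of $A$. It is functorial: a unital $*$-homomorphism $A \to B$ induces, by precomposition on characters, a morphism $\mathrm{Spec}(B) \to \mathrm{Spec}(A)$. *)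

(* Defs.v *)
From HB Require Import structures.
From mathcomp Require Import all_boot all_order all_algebra complex.
From mathcomp Require Import boolp classical_sets reals topology normedtype.

Set Implicit Arguments.
Unset Strict Implicit.
Unset Printing Implicit Defensive.

Import Order.TTheory GRing.Theory Num.Theory.
Import numFieldNormedType.Exports.

Local Open Scope classical_set_scope.
Local Open Scope complex_scope.
Local Open Scope ring_scope.
Local Open Scope sesquilinear_scope.

(** * Categories *)

Record category := Category {
  obj :> Type;
  mor : obj -> obj -> Type;
  idm : forall a, mor a a;
  compm : forall a b c, mor b c -> mor a b -> mor a c;
  compm1 : forall a b (f : mor a b), compm f (idm a) = f;
  comp1m : forall a b (f : mor a b), compm (idm b) f = f;
  compmA : forall a b c d (h : mor c d) (g : mor b c) (f : mor a b),
    compm h (compm g f) = compm (compm h g) f;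
}.
Arguments idm {_} _.
Arguments compm {_ _ _ _} _ _.

Definition isomorphism (C : category) (a b : C) (f : mor a b) :=
  exists g : mor b a, compm g f = idm a /\ compm f g = idm b.

Definition isomorphic (C : category) (a b : C) :=
  exists f : mor a b, isomorphism f.

Definition initial_object (C : category) (a : C) :=
  forall b : C, exists! f : mor a b, True.

Definition opposite (C : category) : category :=
  @Category (obj C) (fun a b => mor b a) (fun a => idm a)
    (fun a b c g f => compm f g)
    (fun a b f => comp1m f) (fun a b f => compm1 f)
    (fun a b c d h g f => esym (compmA f g h)).

Definition full_subcategory (C : category) (P : C -> Prop) : category :=
  @Category {a : C | P a} (fun a b => mor (sval a) (sval b))
    (fun a => idm (sval a)) (fun a b c g f => compm g f)
    (fun a b f => compm1 f) (fun a b f => comp1m f)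
    (fun a b c d h g f => compmA h g f).

Record functor (C D : category) := Functor {
  functor_obj :> C -> D;
  functor_map : forall a b, mor a b -> mor (functor_obj a) (functor_obj b);
  functor_map1 : forall a, functor_map (idm a) = idm (functor_obj a);
  functor_mapM : forall a b c (g : mor b c) (f : mor a b),
    functor_map (compm g f) = compm (functor_map g) (functor_map f);
}.
Arguments functor_map {_ _} _ {_ _} _.

Definition opposite_functor (C D : category) (F : functor C D) :
    functor (opposite C) (opposite D) :=
  @Functor (opposite C) (opposite D) F (fun a b f => functor_map F f)
    (fun a => functor_map1 F a) (fun a b c g f => functor_mapM F f g).

Definition inclusion (C : category) (P : C -> Prop) :
    functor (full_subcategory P) C :=
  @Functor (full_subcategory P) C sval (fun a b f => f)
    (fun a => erefl) (fun a b c g f => erefl).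

Lemma comp_functor1 (C D E : category) (G : functor D E) (F : functor C D) a :
  functor_map G (functor_map F (idm a)) = idm (G (F a)).
Proof. by rewrite !functor_map1. Qed.

Lemma comp_functorM (C D E : category) (G : functor D E) (F : functor C D)
    a b c (g : mor b c) (f : mor a b) :
  functor_map G (functor_map F (compm g f)) =
  compm (functor_map G (functor_map F g)) (functor_map G (functor_map F f)).
Proof. by rewrite !functor_mapM. Qed.

Definition comp_functor (C D E : category) (G : functor D E)
    (F : functor C D) : functor C E :=
  @Functor C E (fun a => G (F a)) (fun a b f => functor_map G (functor_map F f))
    (comp_functor1 G F) (comp_functorM G F).

Definition naturally_isomorphic (C D : category) (F G : functor C D) :=
  exists eta : forall a, mor (F a) (G a),
    (forall a, isomorphism (eta a)) /\
    (forall a b (f : mor a b),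
       compm (eta b) (functor_map F f) = compm (functor_map G f) (eta a)).

(** * Locales *)

HB.mixin Record isLocale d L of Order.TBLattice d L := {
  joins : set L -> L;
  joins_supremums : forall S, supremums S (joins S);
  meet_joinsr : forall (x : L) (S : set L),
    (x `&` joins S)%O = joins [set (x `&` y)%O | y in S];
}.

#[short(type="localeType")]
HB.structure Definition Locale d := {L of isLocale d L & Order.TBLattice d L}.

(* Any display would do: it only selects how the order is printed. *)
Fact locale_display : Order.disp_t. Proof. exact: Order.Disp tt tt. Qed.

Record frame_hom (L K : localeType locale_display) := FrameHom {
  frame_fun :> L -> K;
  frame_top : frame_fun \top%O = \top%O;
  frame_meet : forall x y, frame_fun (x `&` y)%O =
    (frame_fun x `&` frame_fun y)%O;
  frame_joins : forall S, frame_fun (joins S) = joins (frame_fun @` S);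
}.

Lemma frame_hom_eq L K (f g : frame_hom L K) : f =1 g -> f = g.
Proof.
case: f g => [f f1 f2 f3] [g g1 g2 g3] /= /funext fg.
by case: g / fg in g1 g2 g3 *; congr FrameHom; exact: Prop_irrelevance.
Qed.

Definition frame_id (L : localeType locale_display) : frame_hom L L.
Proof.
refine (@FrameHom L L (fun x => x) _ _ _).
- by [].
- by [].
- by move=> S; rewrite image_id.
Defined.

Definition frame_comp (L K M : localeType locale_display)
  (g : frame_hom K M) (f : frame_hom L K) : frame_hom L M.
Proof.
refine (@FrameHom L M (fun x => g (f x)) _ _ _).
- by rewrite !frame_top.
- by move=> x y; rewrite !frame_meet.
- by move=> S; rewrite !frame_joins image_comp.
Defined.

(* A morphism of locales K -> L is a frame homomorphism L -> K. *)
Definition Loc : category.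
Proof.
refine (@Category (localeType locale_display) (fun K L => frame_hom L K)
  frame_id (fun K L M g f => frame_comp f g) _ _ _) => *; exact: frame_hom_eq.
Defined.

Section opens.
Variable T : topologicalType.

Definition open_pred : {pred set T} := fun U => `[< open U >].

Record opens := Opens { open_set :> set T; open_setP : open_set \in open_pred }.

HB.instance Definition _ := [isSub for open_set].
HB.instance Definition _ := [Choice of opens by <:].

Lemma open_pred_meet : {in open_pred &, forall U V, (U `&` V)%O \in open_pred}.
Proof. by move=> U V /asboolP oU /asboolP oV; apply/asboolP/openI. Qed.

Lemma open_pred_join : {in open_pred &, forall U V, (U `|` V)%O \in open_pred}.
Proof. by move=> U V /asboolP oU /asboolP oV; apply/asboolP/openU. Qed.

Lemma open_pred_bot : \bot%O \in open_pred.
Proof. exact/asboolP/open0. Qed.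

Lemma open_pred_top : \top%O \in open_pred.
Proof. exact/asboolP/openT. Qed.

HB.instance Definition _ := Order.isTBLatticeClosed.Build set_display (set T)
  open_pred open_pred_meet open_pred_join open_pred_bot open_pred_top.

HB.instance Definition _ :=
  [SubChoice_isTBSubLattice of opens by <: with locale_display].

Lemma opens_eq (U V : opens) : open_set U = open_set V -> U = V.
Proof. exact: val_inj. Qed.

Lemma opens_leP (U V : opens) : reflect (open_set U `<=` open_set V) (U <= V)%O.
Proof. rewrite leEsub. exact: subsetPset. Qed.

Lemma opens_meetE (U V : opens) : open_set (U `&` V)%O = open_set U `&` open_set V.
Proof. by []. Qed.

Lemma opens_topE : open_set \top%O = setT.
Proof. by []. Qed.

Lemma open_pred_bigcup (S : set opens) :
  (\bigcup_(U in S) open_set U) \in open_pred.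
Proof. apply/asboolP/bigcup_open => U _; exact/asboolP/open_setP. Qed.

Definition opens_joins (S : set opens) : opens := Opens (open_pred_bigcup S).

Lemma opens_joins_supremums S : supremums S (opens_joins S).
Proof.
split=> [U SU|V /= VS]; apply/opens_leP => x.
  by move=> Ux; exists U.
by move=> [U SU Ux]; move: Ux; apply/opens_leP: x; exact: VS.
Qed.

Lemma opens_meet_joinsr (U : opens) (S : set opens) :
  (U `&` opens_joins S)%O = opens_joins [set (U `&` V)%O | V in S].
Proof.
apply/val_inj => /=; apply/seteqP; split => [x [Ux [V SV Vx]]|x].
  by exists (U `&` V)%O => //; exists V.
by move=> [_ [V SV <-]] [Ux Vx]; split => //; exists V.
Qed.

HB.instance Definition _ := isLocale.Build locale_display opens
  opens_joins_supremums opens_meet_joinsr.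

End opens.

Section opens_preimage.
Variables (X Y : topologicalType) (f : X -> Y).
Hypothesis fc : continuous f.

Lemma open_pred_preimage (U : opens Y) : f @^-1` U \in @open_pred X.
Proof.
by move/continuousP: fc => foU; apply/asboolP/foU; exact/asboolP/open_setP.
Qed.

Definition opens_preimage : frame_hom (opens Y) (opens X).
Proof.
refine (@FrameHom (opens Y) (opens X)
  (fun U : opens Y => Opens (open_pred_preimage U)) _ _ _).
- exact/val_inj.
- by move=> U V; exact/val_inj.
- move=> S; apply/val_inj; apply/seteqP; split => x /=.
    by move=> [U SU Ux]; exists (Opens (open_pred_preimage U)) => //; exists U.
  by move=> [_ [U SU <-] Ux]; exists U.
Defined.

End opens_preimage.

HB.instance Definition _ := hasNbhs.Build void principal_filter.
HB.instance Definition _ := Discrete_ofNbhs.Build void erefl.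

(** * C*-algebras *)

(* The library's rings with scalars are nontrivial (1 != 0), which would rule
   out the zero algebra, so the ring operations are part of the mixin; the
   pzRingType instance below gives back the usual notations. *)
HB.mixin Record isCstarAlgebra (R : realType) A
    of CompleteNormedModule R[i] A := {
  cstar_one : A;
  cstar_mul : A -> A -> A;
  star : A -> A;
  cstar_mulA : associative cstar_mul;
  cstar_mul1x : left_id cstar_one cstar_mul;
  cstar_mulx1 : right_id cstar_one cstar_mul;
  cstar_mulDl : left_distributive cstar_mul +%R;
  cstar_mulDr : right_distributive cstar_mul +%R;
  cstar_scaleAl : forall (c : R[i]) (x y : A),
    c *: cstar_mul x y = cstar_mul (c *: x) y;
  cstar_scaleAr : forall (c : R[i]) (x y : A),
    c *: cstar_mul x y = cstar_mul x (c *: y);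
  starK : involutive star;
  starD : {morph star : x y / x + y};
  starZ : forall (c : R[i]) (x : A), star (c *: x) = c^* *: star x;
  starM : forall x y, star (cstar_mul x y) = cstar_mul (star y) (star x);
  cstar_normM : forall x y, `|cstar_mul x y| <= `|x| * `|y|;
  cstar_identity : forall x : A, `|cstar_mul (star x) x| = `|x| ^+ 2;
}.

#[short(type="cstarType")]
HB.structure Definition Cstar_algebra (R : realType) :=
  {A of isCstarAlgebra R A & CompleteNormedModule R[i] A}.

HB.instance Definition _ (R : realType) (A : cstarType R) :=
  GRing.Zmodule_isPzRing.Build A (@cstar_mulA R A) (@cstar_mul1x R A)
    (@cstar_mulx1 R A) (@cstar_mulDl R A) (@cstar_mulDr R A).

Section star_hom.
Variable R : realType.

Record star_hom (A B : cstarType R) := StarHom {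
  star_fun :> A -> B;
  star_fun_linear : linear star_fun;
  star_fun_monoid : monoid_morphism star_fun;
  star_fun_star : {morph star_fun : x / star x};
}.

Lemma star_hom_eq A B (f g : star_hom A B) : f =1 g -> f = g.
Proof.
case: f g => [f f1 f2 f3] [g g1 g2 g3] /= /funext fg.
by case: g / fg in g1 g2 g3 *; congr StarHom; exact: Prop_irrelevance.
Qed.

Definition star_id (A : cstarType R) : star_hom A A.
Proof. by refine (@StarHom A A (fun x => x) _ _ _). Defined.

Definition star_comp (A B C : cstarType R) (g : star_hom B C)
  (f : star_hom A B) : star_hom A C.
Proof.
refine (@StarHom A C (fun x => g (f x)) _ _ _).
- by move=> c x y; rewrite !star_fun_linear.
- have [f1 fM] := star_fun_monoid f; have [g1 gM] := star_fun_monoid g.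
  by split=> [|x y]; rewrite ?f1 ?g1 ?fM ?gM.
- by move=> x; rewrite !star_fun_star.
Defined.

Definition Cstar : category.
Proof.
refine (@Category (cstarType R) star_hom star_id star_comp _ _ _) => *;
  exact: star_hom_eq.
Defined.

Definition is_commutative (A : Cstar) :=
  commutative (@GRing.mul (A : cstarType R)).

Definition cCstar : category := full_subcategory is_commutative.

HB.instance Definition _ (A B : cstarType R) := gen_eqMixin (star_hom A B).
HB.instance Definition _ (A B : cstarType R) := gen_choiceMixin (star_hom A B).

End star_hom.

(** * The complex numbers as a C*-algebra *)

Section complex_cstar.
Variable R : realType.
Import Normc.

Lemma norm_normc (x : R[i]) : `|x| = (normc x)%:C.
Proof. by []. Qed.

Lemma normc_ge0 (x : R[i]) : 0 <= normc x.
Proof. by rewrite -lecR -norm_normc normr_ge0. Qed.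

Lemma normc_Re (x : R[i]) : `|complex.Re x| <= normc x.
Proof.
case: x => a b /=; rewrite -sqrtr_sqr ler_sqrt ?addr_ge0 ?sqr_ge0//.
by rewrite lerDl sqr_ge0.
Qed.

Lemma normc_Im (x : R[i]) : `|complex.Im x| <= normc x.
Proof.
case: x => a b /=; rewrite -sqrtr_sqr ler_sqrt ?addr_ge0 ?sqr_ge0//.
by rewrite lerDr sqr_ge0.
Qed.

Lemma normc_le_ReIm (x : R[i]) : normc x <= `|complex.Re x| + `|complex.Im x|.
Proof.
case: x => a b /=; rewrite -[leRHS]ger0_norm ?addr_ge0// -sqrtr_sqr.
rewrite ler_sqrt ?sqr_ge0// sqrrD !real_normK ?num_real//.
by rewrite lerD2r lerDl mulrn_wge0// mulr_ge0.
Qed.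

Lemma complex_pos (e : R[i]) : 0 < e -> exists2 r : R, 0 < r & r%:C = e.
Proof.
case: e => a b; rewrite ltcE /= => /andP[/eqP-> a0]; exists a => //.
Qed.

Lemma complex_part_cvg (F : set_system R[i]^o) (f : R[i] -> R) :
    ProperFilter F -> cauchy F -> {morph f : x y / x - y} ->
    (forall x, `|f x| <= normc x) -> exists l : R, f @ F --> l.
Proof.
move=> FF /(cauchyP F) Fc fB fle.
suff : cauchy (f @ F) by move=> /R_complete/cvg_ex.
apply/cauchyP => e e0; have [|x xF] := Fc e%:C; first by rewrite ltcR.
exists (f x); rewrite /= nbhs_simpl /=; apply: filterS xF => y.
rewrite -!ball_normE /= norm_normc ltcR -fB => h.
exact: le_lt_trans (fle _) h.
Qed.

Lemma complex_complete (F : set_system R[i]^o) :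
  ProperFilter F -> cauchy F -> cvg F.
Proof.
move=> FF Fc.
have [a aF] : exists l : R, (@complex.Re R) @ F --> l.
  by apply: complex_part_cvg => // [[? ?] [? ?]//|]; exact: normc_Re.
have [b bF] : exists l : R, (@complex.Im R) @ F --> l.
  by apply: complex_part_cvg => // [[? ?] [? ?]//|]; exact: normc_Im.
apply/cvg_ex; exists ((a +i* b) : R[i]^o); apply/cvgrPdist_lt => _ /complex_pos[e e0 <-].
have e20 : 0 < e / 2 by rewrite divr_gt0.
move/cvgrPdist_lt/(_ _ e20) : aF; move/cvgrPdist_lt/(_ _ e20) : bF => bF aF.
near=> z; rewrite norm_normc ltcR.
apply: le_lt_trans (normc_le_ReIm _) _; rewrite [e]splitr.
rewrite ltrD//=.
- rewrite (_ : complex.Re _ = a - complex.Re z); last by case: (z).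
  by near: z.
- rewrite (_ : complex.Im _ = b - complex.Im z); last by case: (z).
  by near: z.
Unshelve. all: by end_near. Qed.

(* An alias, because the library's completeness instance for R^o with
   R : realType prevents one from being declared on R[i]^o. *)
Definition complex_algebra : Type := R[i]^o.

HB.instance Definition _ := NormedModule.copy complex_algebra R[i]^o.
HB.instance Definition _ :=
  Uniform_isComplete.Build complex_algebra complex_complete.

Lemma conjc_identity (x : R[i]) : `|x^* * x| = `|x| ^+ 2.
Proof.
by rewrite normrM expr2 !norm_normc; case: x => a b /=; rewrite sqrrN.
Qed.

Let starZ (c x : R[i]) : (c * x)^* = c^* * x^*.
Proof. exact: rmorphM. Qed.

Let starM (x y : R[i]) : (x * y)^* = y^* * x^*.
Proof. by rewrite rmorphM mulrC. Qed.

Let normM (x y : R[i]) : `|x * y| <= `|x| * `|y|.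
Proof. by rewrite normrM. Qed.

HB.instance Definition _ := isCstarAlgebra.Build R complex_algebra
  (@mulrA R[i]) (@mul1r R[i]) (@mulr1 R[i]) (@mulrDl R[i]) (@mulrDr R[i])
  (@mulrA R[i]) (@mulrCA R[i]) (@conjcK R) (rmorphD (@conjc R)) starZ starM
  normM conjc_identity.
End complex_cstar.

(** * The Gelfand spectrum *)

Section spectrum.
Variable R : realType.
Implicit Types A B : cstarType R.

Definition character_eval A (chi : star_hom A (complex_algebra R)) :
  {ptws A -> complex_algebra R} := chi.

(* The unital *-homomorphisms A -> C with the topology of pointwise
   convergence. *)
Definition character A : Type := initial_topology (@character_eval A).

HB.instance Definition _ A := Topological.on (character A).

Definition character_comp A B (f : star_hom A B) (chi : character B) :
  character A := star_comp (chi : star_hom B (complex_algebra R)) f.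

Lemma character_comp_continuous A B (f : star_hom A B) :
  continuous (character_comp f).
Proof.
apply: continuous_comp_initial => chi.
have chiF : Filter (nbhs chi) by exact: nbhs_filter.
have FA : Filter ((@character_eval A \o character_comp f) @ chi).
  exact: fmap_filter.
apply/(pointwise_cvgP (F := (@character_eval A \o character_comp f) @ chi)) => a.
have FB : Filter (@character_eval B @ chi) by exact: fmap_filter.
have : @character_eval B @ chi --> character_eval chi.
  exact: initial_continuous.
by move/(pointwise_cvgP (F := @character_eval B @ chi))/(_ (f a)).
Qed.

Definition Spec_map A B (f : star_hom A B) :
    frame_hom (opens (character A)) (opens (character B)) :=
  opens_preimage (@character_comp_continuous A B f).

Lemma Spec_map_id A : Spec_map (star_id A) = frame_id (opens (character A)).
Proof.
have E : character_comp (star_id A) = id.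
  by apply/funext => chi; exact: star_hom_eq.
by apply: frame_hom_eq => U; apply: opens_eq; rewrite /= E.
Qed.

Lemma Spec_map_comp A B C (g : star_hom B C) (f : star_hom A B) :
  Spec_map (star_comp g f) = frame_comp (Spec_map g) (Spec_map f).
Proof.
have E : character_comp (star_comp g f) = character_comp f \o character_comp g.
  by apply/funext => chi; exact: star_hom_eq.
by apply: frame_hom_eq => U; apply: opens_eq; rewrite /= E.
Qed.

Definition Spec : functor (opposite (cCstar R)) Loc :=
  @Functor (opposite (cCstar R)) Loc
    (fun X => opens (character (sval X : cstarType R)))
    (fun X Y f => Spec_map f)
    (fun X => Spec_map_id _) (fun X Y Z g f => Spec_map_comp _ _).

End spectrum.

(** * Matrices as a C*-algebra *)

Section matrix_cstar.
Variable R : realType.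
Import Normc.

(* The Euclidean norm on C^n. *)
Definition l2norm n (v : 'cV[R[i]]_n) : R :=
  Num.sqrt (\sum_i normc (v i 0) ^+ 2).

(* The operator norm on M_n(C). *)
Definition opnorm n (A : 'M[R[i]]_n) : R :=
  sup [set l2norm (A *m v) | v in [set v | l2norm v <= 1]].

Section norms.
Variable n : nat.
Implicit Types (u v : 'cV[R[i]]_n) (A B : 'M[R[i]]_n).

Lemma normc_real (x : R) : 0 <= x -> normc x%:C = x.
Proof. by move=> x0; rewrite /= expr0n addr0 sqrtr_sqr ger0_norm. Qed.

Lemma l2norm_ge0 v : 0 <= l2norm v.
Proof. exact: sqrtr_ge0. Qed.

Lemma l2norm_sqr v : l2norm v ^+ 2 = \sum_i normc (v i 0) ^+ 2.
Proof. by rewrite sqr_sqrtr// sumr_ge0// => i _; rewrite sqr_ge0. Qed.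

Lemma dotmx_l2norm v : dotmx v^T v^T = (l2norm v ^+ 2)%:C.
Proof.
rewrite l2norm_sqr dotmxE mxE rmorph_sum; apply: eq_bigr => i _.
by rewrite !mxE -normCK norm_normc rmorphXn.
Qed.

Lemma l2normE v : (l2norm v)%:C = sqrtC (dotmx v^T v^T).
Proof. by rewrite dotmx_l2norm rmorphXn sqrCK// lecR l2norm_ge0. Qed.

Lemma l2normD u v : l2norm (u + v) <= l2norm u + l2norm v.
Proof.
rewrite -lecR rmorphD /= !l2normE linearD /=.
have [+ _] := triangle_lerif (@dotmx _ n) u^T v^T; exact.
Qed.

Lemma l2normZ c v : l2norm (c *: v) = normc c * l2norm v.
Proof.
apply/eqP; rewrite -(eqrXn2 (n := 2))// ?mulr_ge0 ?l2norm_ge0 ?normc_ge0//.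
rewrite exprMn !l2norm_sqr mulr_sumr; apply/eqP/eq_bigr => i _.
by rewrite mxE normcM exprMn.
Qed.

Lemma l2norm_CS u v : normc (dotmx u^T v^T) <= l2norm u * l2norm v.
Proof.
rewrite -lecR rmorphM /= !l2normE -norm_normc.
have [+ _] := CauchySchwarz_sqrt (@dotmx _ n) u^T v^T; exact.
Qed.

Lemma l2norm_coord v i : normc (v i 0) <= l2norm v.
Proof.
rewrite -[leLHS]ger0_norm ?normc_ge0// -sqrtr_sqr ler_sqrt; last first.
  by rewrite sumr_ge0// => j _; rewrite sqr_ge0.
by rewrite (bigD1 i)//= lerDl sumr_ge0// => j _; rewrite sqr_ge0.
Qed.

Lemma l2norm_le_sum v : l2norm v <= \sum_i normc (v i 0).
Proof.
have s0 : 0 <= \sum_i normc (v i 0) by rewrite sumr_ge0// => i _; exact: normc_ge0.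
rewrite -[leRHS]ger0_norm// -sqrtr_sqr ler_sqrt ?sqr_ge0//.
suff [] : 0 <= \sum_i normc (v i 0) /\
  \sum_i normc (v i 0) ^+ 2 <= (\sum_i normc (v i 0)) ^+ 2 by [].
apply: (big_ind2 (fun x y => 0 <= y /\ x <= y ^+ 2)).
- by rewrite expr0n.
- move=> x1 x2 y1 y2 [x20 x12] [y20 y12]; split; first exact: addr_ge0.
  rewrite sqrrD (le_trans (lerD x12 y12))// addrAC lerDl mulrn_wge0//.
  exact: mulr_ge0.
- by move=> i _; rewrite normc_ge0.
Qed.

Lemma l2norm_delta (j : 'I_n) : l2norm (delta_mx j 0) = 1.
Proof.
rewrite /l2norm (bigD1 j)//= mxE !eqxx normc1 expr1n big1 ?addr0 ?sqrtr1//.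
by move=> i /negPf ij; rewrite mxE ij normc0 expr0n.
Qed.

Lemma l2norm0 : l2norm (0 : 'cV[R[i]]_n) = 0.
Proof. by rewrite -[X in l2norm X](scale0r 0) l2normZ normc0 mul0r. Qed.

Lemma l2norm_eq0 v : l2norm v = 0 -> v = 0.
Proof.
move=> v0; apply/matrixP => i j; rewrite ord1 mxE; apply: eq0_normc.
by apply/le_anti; rewrite normc_ge0 -v0 l2norm_coord.
Qed.

Lemma l2norm_mul_le_sum A v :
  l2norm v <= 1 -> l2norm (A *m v) <= \sum_i \sum_j normc (A i j).
Proof.
move=> v1; apply: le_trans (l2norm_le_sum _) _; apply: ler_sum => i _.
rewrite -lecR -norm_normc mxE; apply: le_trans (ler_norm_sum _ _ _) _.
rewrite rmorph_sum; apply: ler_sum => j _; rewrite norm_normc lecR normcM.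
by rewrite ler_piMr ?normc_ge0// (le_trans (l2norm_coord _ _)).
Qed.

Lemma opnorm_has_sup A :
  has_sup [set l2norm (A *m v) | v in [set v | l2norm v <= 1]].
Proof.
split; first by exists (l2norm (A *m 0)), 0 => //=; rewrite l2norm0.
exists (\sum_i \sum_j normc (A i j)) => _ [v v1 <-].
exact: l2norm_mul_le_sum.
Qed.

Lemma opnorm_ge0 A : 0 <= opnorm A.
Proof.
apply: le_trans (l2norm_ge0 (A *m 0)) _; apply: sup_upper_bound.
  exact: opnorm_has_sup.
by exists 0 => //=; rewrite l2norm0.
Qed.

Lemma opnorm_le A v : l2norm (A *m v) <= opnorm A * l2norm v.
Proof.
have [v0|v0] := eqVneq (l2norm v) 0.
  by rewrite (l2norm_eq0 v0) mulmx0 l2norm0 mulr0.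
have vpos : 0 < l2norm v by rewrite lt_def v0 l2norm_ge0.
rewrite -ler_pdivrMr// mulrC.
have nv : normc ((l2norm v)^-1)%:C = (l2norm v)^-1.
  by rewrite normc_real// invr_ge0 ltW.
rewrite -[X in X * _]nv -l2normZ scalemxAr; apply: sup_upper_bound.
  exact: opnorm_has_sup.
by exists (((l2norm v)^-1)%:C *: v) => //=; rewrite l2normZ nv mulVf.
Qed.

Lemma opnorm_lub A (M : R) : 0 <= M ->
  (forall v, l2norm (A *m v) <= M * l2norm v) -> opnorm A <= M.
Proof.
move=> M0 AM; apply: ge_sup; first by case: (opnorm_has_sup A).
by move=> _ [v v1 <-]; apply: le_trans (AM v) _; rewrite ler_piMr.
Qed.

Lemma opnorm_le_sum A : opnorm A <= \sum_i \sum_j normc (A i j).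
Proof.
apply: ge_sup; first by case: (opnorm_has_sup A).
by move=> _ [v v1 <-]; exact: l2norm_mul_le_sum.
Qed.

Lemma opnorm_entry A i j : normc (A i j) <= opnorm A.
Proof.
have := opnorm_le A (delta_mx j 0); rewrite l2norm_delta mulr1; apply: le_trans.
by rewrite -colE; have := l2norm_coord (col j A) i; rewrite mxE.
Qed.

Lemma opnormD A B : opnorm (A + B) <= opnorm A + opnorm B.
Proof.
apply: opnorm_lub => [|v]; first by rewrite addr_ge0 ?opnorm_ge0.
rewrite mulmxDl mulrDl (le_trans (l2normD _ _))//.
by rewrite lerD// opnorm_le.
Qed.

Lemma opnormZ_le c A : opnorm (c *: A) <= normc c * opnorm A.
Proof.
apply: opnorm_lub => [|v]; first by rewrite mulr_ge0 ?opnorm_ge0 ?normc_ge0.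
by rewrite -scalemxAl l2normZ -mulrA ler_wpM2l ?normc_ge0 ?opnorm_le.
Qed.

Lemma opnorm_eq0 A : opnorm A = 0 -> A = 0.
Proof.
move=> A0; apply/matrixP => i j; rewrite mxE; apply: eq0_normc.
by apply/le_anti; rewrite normc_ge0 -A0 opnorm_entry.
Qed.

Lemma opnormZ c A : opnorm (c *: A) = normc c * opnorm A.
Proof.
apply/le_anti; rewrite opnormZ_le /=; have [->|c0] := eqVneq c 0.
  by rewrite normc0 mul0r opnorm_ge0.
have nc0 : 0 < normc c.
  rewrite lt_def normc_ge0 andbT; apply: contra c0 => /eqP/eq0_normc ->//.
rewrite -ler_pdivlMl//; have := opnormZ_le c^-1 (c *: A).
by rewrite scalerA mulVf// scale1r normcV.
Qed.

Lemma opnormM A B : opnorm (A *m B) <= opnorm A * opnorm B.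
Proof.
apply: opnorm_lub => [|v]; first by rewrite mulr_ge0 ?opnorm_ge0.
rewrite -mulmxA (le_trans (opnorm_le _ _))// -mulrA.
by rewrite ler_wpM2l ?opnorm_ge0 ?opnorm_le.
Qed.

Lemma dotmx_adjoint A u v :
  dotmx (A *m u)^T v^T = dotmx u^T (A ^t* *m v)^T.
Proof.
rewrite !dotmxE; congr (fun_of_matrix _ 0 0).
rewrite trmx_mul -mulmxA; congr (_ *m _); rewrite !trmxK map_mxM /=.
by congr (_ *m _); apply/matrixP => i j; rewrite !mxE conjCK.
Qed.

Lemma opnorm_star_le A : opnorm (A ^t*) <= opnorm A.
Proof.
apply: opnorm_lub => [|v]; first exact: opnorm_ge0.
have [->|Av0] := eqVneq (l2norm (A ^t* *m v)) 0.
  by rewrite mulr_ge0 ?opnorm_ge0 ?l2norm_ge0.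
have Avpos : 0 < l2norm (A ^t* *m v) by rewrite lt_def Av0 l2norm_ge0.
rewrite -(ler_pM2l Avpos) -expr2.
have h := l2norm_CS (A *m (A ^t* *m v)) v; rewrite dotmx_adjoint dotmx_l2norm in h.
rewrite normc_real ?sqr_ge0// in h; apply: le_trans h _.
by rewrite mulrCA mulrA ler_wpM2r ?l2norm_ge0// opnorm_le.
Qed.

Lemma opnorm_cstar A : opnorm (A ^t* *m A) = opnorm A ^+ 2.
Proof.
apply/le_anti/andP; split.
  by rewrite (le_trans (opnormM _ _))// expr2 ler_wpM2r ?opnorm_ge0 ?opnorm_star_le.
rewrite -[leRHS]sqr_sqrtr ?opnorm_ge0// lerXn2r ?nnegrE ?opnorm_ge0 ?sqrtr_ge0//.
apply: opnorm_lub => [|v]; first exact: sqrtr_ge0.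
rewrite -(ler_pXn2r (n := 2))// ?nnegrE ?mulr_ge0 ?l2norm_ge0 ?sqrtr_ge0//.
rewrite exprMn (sqr_sqrtr (opnorm_ge0 _)).
have h := l2norm_CS v (A ^t* *m (A *m v)); rewrite -dotmx_adjoint dotmx_l2norm in h.
rewrite normc_real ?sqr_ge0// in h; apply: le_trans h _.
rewrite mulmxA expr2 mulrCA ler_wpM2l ?l2norm_ge0//; exact: opnorm_le.
Qed.

End norms.

(* An alias of 'M[R[i]]_n, whose norm in the library is the maximum norm. *)
Definition matrix_algebra (n : nat) : Type := 'M[R[i]]_n.

Section matrix_algebra.
Variable n : nat.
Implicit Types A B : 'M[R[i]]_n.

HB.instance Definition _ := GRing.Lmodule.on (matrix_algebra n).

Lemma matrix_normD A B : (opnorm (A + B))%:C <= (opnorm A)%:C + (opnorm B)%:C.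
Proof. by rewrite -rmorphD lecR opnormD. Qed.

Lemma matrix_normZ (c : R[i]) A : (opnorm (c *: A))%:C = `|c| * (opnorm A)%:C.
Proof. by rewrite opnormZ rmorphM. Qed.

Lemma matrix_norm_eq0 A : (opnorm A)%:C = 0 -> A = 0.
Proof. by move=> /complexI/opnorm_eq0. Qed.

HB.instance Definition _ := Lmodule_isNormed.Build R[i] (matrix_algebra n)
  matrix_normD matrix_normZ matrix_norm_eq0.

Lemma matrix_normE (A : matrix_algebra n) : `|A| = (opnorm A)%:C.
Proof. by []. Qed.

Lemma matrix_complete (F : set_system (matrix_algebra n)) :
  ProperFilter F -> cauchy F -> cvg F.
Proof.
move=> FF /(cauchyP F) Fc.
have L i j : exists l : complex_algebra R,
    (fun A : matrix_algebra n => A i j : complex_algebra R) @ F --> l.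
  suff : cauchy ((fun A : matrix_algebra n => A i j : complex_algebra R) @ F).
    by move=> /cauchy_cvg/cvg_ex.
  apply/cauchyP => e e0; have [A FA] := Fc e e0.
  exists (A i j : complex_algebra R); rewrite /= nbhs_simpl /=.
  apply: filterS FA => B; rewrite -!ball_normE /= => h.
  apply: le_lt_trans h; rewrite matrix_normE norm_normc lecR.
  by have := opnorm_entry (A - B) i j; rewrite !mxE.
pose l i j := projT1 (cid (L i j)).
have lF i j : (fun A : matrix_algebra n => A i j : complex_algebra R) @ F --> l i j.
  exact: projT2 (cid (L i j)).
apply/cvg_ex; exists (\matrix_(i, j) (l i j : R[i]) : matrix_algebra n).
apply/cvgrPdist_lt => _ /complex_pos[e e0 <-].
pose d := e / (n * n).+1%:R.
have d0 : 0 < d%:C by rewrite ltcR divr_gt0.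
have H : \forall A \near F, forall i j, `|(l i j : R[i]) - (A : 'M_n) i j| < d%:C.
  apply: filter_forall => i; apply: filter_forall => j.
  by move/cvgrPdist_lt/(_ _ d0) : (lF i j).
apply: filterS H => A H; rewrite matrix_normE ltcR.
apply: le_lt_trans (opnorm_le_sum _) _.
apply: (@le_lt_trans _ _ (\sum_(i < n) \sum_(j < n) d)).
  apply: ler_sum => i _; apply: ler_sum => j _.
  by have := ltW (H i j); rewrite norm_normc lecR !mxE.
rewrite !sumr_const !card_ord -mulrnA -mulr_natr mulrAC ltr_pdivrMr ?ltr0n//.
by rewrite ltr_pM2l// ltr_nat.
Qed.

HB.instance Definition _ :=
  Uniform_isComplete.Build (matrix_algebra n) matrix_complete.

Let starD A B : (A + B) ^t* = A ^t* + B ^t*.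
Proof. by rewrite linearD /= map_mxD. Qed.

Let starZ (c : R[i]) A : (c *: A) ^t* = c^* *: A ^t*.
Proof. by apply/matrixP => i j; rewrite !mxE rmorphM. Qed.

Let starM A B : (A *m B) ^t* = B ^t* *m A ^t*.
Proof. by rewrite trmx_mul map_mxM. Qed.

Let normM A B : (opnorm (A *m B))%:C <= (opnorm A)%:C * (opnorm B)%:C.
Proof. by rewrite -rmorphM lecR opnormM. Qed.

Let cstar_identity A : (opnorm (A ^t* *m A))%:C = (opnorm A)%:C ^+ 2.
Proof. by rewrite opnorm_cstar rmorphXn. Qed.

HB.instance Definition _ := isCstarAlgebra.Build R (matrix_algebra n)
  (@mulmxA R[i] n n n n) (@mul1mx R[i] n n) (@mulmx1 R[i] n n)
  (@mulmxDl R[i] n n n) (@mulmxDr R[i] n n n)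
  (@scalemxAl R[i] n n n) (@scalemxAr R[i] n n n)
  (@trmxCK R[i] n n) starD starZ starM normM cstar_identity.

End matrix_algebra.
End matrix_cstar.

(* Main.v *)
Require Import Defs.
From HB Require Import structures.
From mathcomp Require Import all_boot all_order all_algebra complex.
From mathcomp Require Import boolp classical_sets reals topology normedtype.
From mathcomp Require Import ring lra.

(** The functor [G] is pinned down on commutative algebras, and a projection
    [p] of a C*-algebra [A] is a unital *-homomorphism from C^2 to [A], namely
    the one with [(x, y) |-> x p + y (1 - p)].  Applying [G] to it and pulling
    back the open point of the spectrum of C^2 on which [(1, 0)] does not
    vanish attaches to [p] an element [mu p] of the frame [G A].  Two
    orthogonal projections come from one homomorphism out of C^3, where
    everything is computed in a spectrum; hence [mu] turns orthogonal sums into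
    disjoint joins, and [mu 1 = \top] ([exists_measure]).

    So [mu] is the analogue, with values in a frame, of a two-valued state, and
    the Kochen-Specker theorem says that matrices of size at least three have
    no such state.  The classical argument by contradiction (colour the rays of
    R^3 by true and false, exactly one true ray in each orthogonal frame)
    becomes a computation with inequalities in a distributive lattice.  Write
    [m x] for the element of the ray of [x].  The eight-vector gadget of
    Kochen and Specker shows that two rays whose angle is close enough to a
    right angle are already disjoint, equivalently that [m a <= m b] whenever
    [a] and [b] are close enough ([gadget_le]).  Five such steps of rational
    slope lead from the first coordinate axis to the second one, so the
    element of the first axis lies below one that it is disjoint from, and is
    [\bot] ([kochen_specker_lattice]).

    Each diagonal matrix unit of [M_n] is the first axis of some coordinate
    copy of R^3 when [n >= 3], so [mu] vanishes on it; the diagonal units add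
    up to [1], whence [\top = \bot] in [G M_n] ([additive_bot]).  A frame in
    which [\top = \bot] has one element, and is initial as a locale. *)

Set Implicit Arguments.
Unset Strict Implicit.
Unset Printing Implicit Defensive.

Import Order.TTheory GRing.Theory Num.Theory.
Import numFieldNormedType.Exports.

Local Open Scope classical_set_scope.
Local Open Scope complex_scope.
Local Open Scope ring_scope.
Local Open Scope sesquilinear_scope.

(** * The lattice-valued Kochen-Specker theorem in dimension three *)

Definition dotr (R : pzRingType) n (x y : 'rV[R]_n) : R := (x *m y^T) 0 0.

Definition row3 (R : pzRingType) (a b c : R) : 'rV[R]_3 :=
  \row_j [tuple a; b; c]`_j.

Lemma dotr_row3 (R : pzRingType) (a b c a' b' c' : R) :
  dotr (row3 a b c) (row3 a' b' c') = a * a' + b * b' + c * c'.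
Proof.
by rewrite /dotr mxE !big_ord_recl big_ord0 !mxE /= addr0 addrA.
Qed.

Lemma row3Z (R : pzRingType) (k a b c : R) :
  k *: row3 a b c = row3 (k * a) (k * b) (k * c).
Proof. by apply/rowP => -[[|[|[|]]]] // i; rewrite !mxE. Qed.

Lemma row3_neq0 (R : pzRingType) (a b c : R) :
  [|| a != 0, b != 0 | c != 0] -> row3 a b c != 0.
Proof.
apply: contraTN => /eqP/rowP r0; rewrite !negb_or !negbK.
have := r0 0; have := r0 1; have := r0 2; rewrite !mxE /= => -> -> ->.
by rewrite eqxx.
Qed.

Section kochen_specker.
Variables (R : rcfType) (d : Order.disp_t) (L : bDistrLatticeType d).
Variables (m : 'rV[R]_3 -> L) (w : L).
Hypothesis mZ : forall k x, k != 0 -> m (k *: x) = m x.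
Hypothesis m_orth : forall x y, x != 0 -> y != 0 -> dotr x y = 0 ->
  (m x `&` m y)%O = \bot%O.
Hypothesis m_triad : forall x y z, x != 0 -> y != 0 -> z != 0 ->
  dotr x y = 0 -> dotr x z = 0 -> dotr y z = 0 ->
  (m x `|` m y `|` m z)%O = w.

Lemma le_joinr_disjoint (a x y : L) :
  (a <= x `|` y -> a `&` x = \bot -> a <= y)%O.
Proof.
move=> axy ax0; rewrite -(meet_idPl axy) meetUr ax0 join0x.
exact: leIr.
Qed.

(** The Kochen-Specker gadget.  In the plane of the first two coordinates let
    [u], [v] be orthogonal of equal length, obtained by rotating [(a, b)] by
    the angle of tangent [- g] and then by a right angle, and let [s] be that
    length, so that [s e3] completes them to a frame.  The ray [A] of
    [u + g v] is that of [(a, b)]; [B] is the ray of [u + 2 g v], and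
    [C = 2 g u - v] is orthogonal to [B].  The vectors [E1 = u + s e3] and
    [E2 = u - s e3] are orthogonal, each lies in a frame [X, X', E1],
    [Y, Y', E2] with [X], [Y] orthogonal to [A] and [X'], [Y'] orthogonal to
    [C].  Below both [m A] and [m C] one is therefore below both [m E1] and
    [m E2]: [A] and [C] are disjoint though not orthogonal.  In the frame
    [B, C, e3] only [B] is left for [A]. *)
Lemma gadget_le (a b g : R) : (a, b) != (0, 0) ->
  (m (row3 a b 0) <=
   m (row3 ((1 + 2 * g ^+ 2) * a - g * b) ((1 + 2 * g ^+ 2) * b + g * a) 0))%O.
Proof.
move=> ab0.
have N0 : 0 < a ^+ 2 + b ^+ 2.
  move: ab0; rewrite lt_def addr_ge0 ?sqr_ge0// andbT.
  by rewrite paddr_eq0 ?sqr_ge0// !sqrf_eq0.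
have g0 : 0 < 1 + g ^+ 2 by rewrite ltr_pwDl ?sqr_ge0.
pose s := Num.sqrt ((1 + g ^+ 2) * (a ^+ 2 + b ^+ 2)).
have sE : s * s = (1 + g ^+ 2) * (a ^+ 2 + b ^+ 2).
  by rewrite -expr2 sqr_sqrtr// mulr_ge0 ?ltW.
have -> : m (row3 a b 0) = m (row3 ((1 + g ^+ 2) * a) ((1 + g ^+ 2) * b) 0).
  by rewrite -(mZ _ (lt0r_neq0 g0)) row3Z mulr0.
pose u1 := a + g * b; pose u2 := b - g * a.
pose v1 := g * a - b; pose v2 := g * b + a.
pose K := (1 + g ^+ 2) * (a ^+ 2 + b ^+ 2).
have K0 : 0 < K by rewrite mulr_gt0.
(* All the vectors below have a squared length of this form, which makes them
   nonzero. *)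
have nz k l x y z : 0 < k -> 0 <= l ->
    x ^+ 2 + y ^+ 2 + z ^+ 2 = k * (1 + l * g ^+ 2) * K -> row3 x y z != 0.
  move=> k0 l0 h; apply: row3_neq0.
  have : x ^+ 2 + y ^+ 2 + z ^+ 2 != 0.
    by rewrite h gt_eqF// !mulr_gt0// ltr_pwDl// mulr_ge0 ?sqr_ge0.
  apply: contraNT; rewrite !negb_or !negbK => /and3P[/eqP-> /eqP-> /eqP->].
  by rewrite expr0n !addr0.
set A := row3 _ _ _; set B := row3 _ _ 0.
pose C := row3 (2 * g * u1 - v1) (2 * g * u2 - v2) 0.
pose D := row3 0 0 1 : 'rV[R]_3.
pose E1 := row3 u1 u2 s; pose E2 := row3 u1 u2 (- s).
pose X := row3 (g * u1 - v1) (g * u2 - v2) (- (g * s)).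
pose X' := row3 (u1 + 2 * g * v1) (u2 + 2 * g * v2) (- s).
pose Y := row3 (g * u1 - v1) (g * u2 - v2) (g * s).
pose Y' := row3 (u1 + 2 * g * v1) (u2 + 2 * g * v2) s.
(* Linear arithmetic treats the monomials in s as atoms: it needs the multiples
   of [sE] that occur in the squared lengths and inner products. *)
have sg : g * (s * s) = g * K by rewrite sE.
have sgg : g ^+ 2 * (s * s) = g ^+ 2 * K by rewrite sE.
rewrite /K in sg sgg.
have A0 : A != 0 by apply: (@nz 1 1); rewrite // /K; ring.
have B0 : B != 0 by apply: (@nz 1 4); rewrite // /K; ring.
have C0 : C != 0 by apply: (@nz 1 4); rewrite // /K /u1 /u2 /v1 /v2; ring.
have D0 : D != 0 by apply: row3_neq0; rewrite oner_eq0 !orbT.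
have E10 : E1 != 0 by apply: (@nz 2 0); rewrite // /K /u1 /u2; lra.
have E20 : E2 != 0 by apply: (@nz 2 0); rewrite // /K /u1 /u2; lra.
have X0 : X != 0 by apply: (@nz 1 2); rewrite // /K /u1 /u2 /v1 /v2; lra.
have Y0 : Y != 0 by apply: (@nz 1 2); rewrite // /K /u1 /u2 /v1 /v2; lra.
have X'0 : X' != 0 by apply: (@nz 2 2); rewrite // /K /u1 /u2 /v1 /v2; lra.
have Y'0 : Y' != 0 by apply: (@nz 2 2); rewrite // /K /u1 /u2 /v1 /v2; lra.
have aW : (m A <= w)%O.
  pose A' := row3 (- b) a 0.
  rewrite -(m_triad A0 (_ : A' != 0) D0) ?dotr_row3; first by rewrite -joinA leUl.
  - apply: row3_neq0; move: ab0; rewrite oppr_eq0 eqxx orbF.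
    by apply: contraNT; rewrite negb_or !negbK => /andP[/eqP-> /eqP->].
  - ring.
  - ring.
  - ring.
have ac : (m A `&` m C = \bot)%O.
  have E1w : (m A `&` m C <= m E1)%O.
    apply: (@le_joinr_disjoint _ (m X)).
      apply: (@le_joinr_disjoint _ (m X')).
        by rewrite joinCA joinA m_triad// ?(le_trans (leIl _ _) aW)// dotr_row3
           /u1 /u2 /v1 /v2; lra.
      rewrite -meetA [(m C `&` _)%O]m_orth ?meetx0//.
      by rewrite dotr_row3 /u1 /u2 /v1 /v2; lra.
    rewrite meetAC m_orth ?meet0x//.
    by rewrite dotr_row3 /u1 /u2 /v1 /v2; lra.
  have E2w : (m A `&` m C <= m E2)%O.
    apply: (@le_joinr_disjoint _ (m Y)).
      apply: (@le_joinr_disjoint _ (m Y')).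
        by rewrite joinCA joinA m_triad// ?(le_trans (leIl _ _) aW)// dotr_row3
           /u1 /u2 /v1 /v2; lra.
      rewrite -meetA [(m C `&` _)%O]m_orth ?meetx0//.
      by rewrite dotr_row3 /u1 /u2 /v1 /v2; lra.
    rewrite meetAC m_orth ?meet0x//.
    by rewrite dotr_row3 /u1 /u2 /v1 /v2; lra.
  have E12 : (m E1 `&` m E2 = \bot)%O.
    by apply: m_orth => //; rewrite dotr_row3 /u1 /u2; lra.
  by apply/eqP; rewrite -lex0 -E12 lexI E1w.
apply: (@le_joinr_disjoint _ (m C)) => //.
apply: (@le_joinr_disjoint _ (m D)); last first.
  by apply: m_orth => //; rewrite dotr_row3; ring.
rewrite joinC m_triad// dotr_row3 /u1 /u2 /v1 /v2; ring.
Qed.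

(** In complex notation [gadget_le] multiplies [a + i b] by
    [(1 + 2 g^2) + i g = (1 + 2 g i) (1 - g i)].  For [g = 1, 1, 1, 2/3, 3/2]
    these are, up to positive rational factors, [3 + i] three times,
    [17 + 6 i] and [11 + 3 i], and their product is purely imaginary. *)
Lemma kochen_specker_lattice : m (row3 1 0 0) = \bot%O.
Proof.
have step (a b a' b' g k : R) : (a, b) != (0, 0) -> k != 0 ->
    (1 + 2 * g ^+ 2) * a - g * b = k * a' ->
    (1 + 2 * g ^+ 2) * b + g * a = k * b' ->
    (m (row3 a b 0) <= m (row3 a' b' 0))%O.
  move=> ab k0 ea eb; apply: le_trans (gadget_le g ab) _.
  by rewrite ea eb -[0 in X in (X <= _)%O](mulr0 k) -row3Z mZ.
have le : (m (row3 1 0 0) <= m (row3 0 1 0))%O.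
  have s1 : (m (row3 1 0 0) <= m (row3 3 1 0))%O.
    by apply: (step _ _ _ _ 1 1); rewrite ?xpair_eqE ?oner_eq0 ?pnatr_eq0 //; field.
  have s2 : (m (row3 3 1 0) <= m (row3 4 3 0))%O.
    by apply: (step _ _ _ _ 1 2); rewrite ?xpair_eqE ?oner_eq0 ?pnatr_eq0 //; field.
  have s3 : (m (row3 4 3 0) <= m (row3 9 13 0))%O.
    by apply: (step _ _ _ _ 1 1); rewrite ?xpair_eqE ?oner_eq0 ?pnatr_eq0 //; field.
  have s4 : (m (row3 9 13 0) <= m (row3 3 11 0))%O.
    apply: (step _ _ _ _ (2 / 3) (25 / 9));
      rewrite ?xpair_eqE ?oner_eq0 ?pnatr_eq0 //; last 2 first.
    - by field.
    - by field.
    by rewrite mulf_neq0 ?invr_eq0 ?pnatr_eq0.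
  have s5 : (m (row3 3 11 0) <= m (row3 0 1 0))%O.
    by apply: (step _ _ _ _ (3 / 2) 65);
      rewrite ?xpair_eqE ?oner_eq0 ?pnatr_eq0 //; field.
  by rewrite (le_trans s1)// (le_trans s2)// (le_trans s3)// (le_trans s4).
apply/eqP; rewrite -lex0 -(@m_orth (row3 1 0 0) (row3 0 1 0)) ?lexI ?lexx//.
- by rewrite row3_neq0// oner_eq0.
- by rewrite row3_neq0// oner_eq0 orbT.
- by rewrite dotr_row3; ring.
Qed.

End kochen_specker.

(** * Additive functions on real projections *)

Definition orthoproj (R : pzRingType) n (A : 'M[R]_n) := A^T = A /\ A *m A = A.

Definition rayproj (R : fieldType) n (v : 'rV[R]_n) : 'M[R]_n :=
  (dotr v v)^-1 *: (v^T *m v).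

Section ray.
Variables (R : realFieldType) (n : nat).
Implicit Types (v x y z : 'rV[R]_n).

Lemma dotrE x y : x *m y^T = (dotr x y)%:M.
Proof. exact: mx11_scalar. Qed.

Lemma dotr_sum x y : dotr x y = \sum_k x 0 k * y 0 k.
Proof. by rewrite /dotr mxE; apply: eq_bigr => k _; rewrite mxE. Qed.

Lemma dotrC x y : dotr x y = dotr y x.
Proof. by rewrite !dotr_sum; apply: eq_bigr => k _; rewrite mulrC. Qed.

Lemma dotr_neq0 v : v != 0 -> dotr v v != 0.
Proof.
apply: contraNN; rewrite /dotr mxE psumr_eq0; last first.
  by move=> i _; rewrite mxE -expr2 sqr_ge0.
move=> /allP v0; apply/eqP/rowP => i; apply/eqP.
by have := v0 i; rewrite mem_index_enum !mxE -expr2 sqrf_eq0; exact.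
Qed.

Lemma rayproj_mul x y :
  rayproj x *m rayproj y = ((dotr x x)^-1 * (dotr y y)^-1 * dotr x y) *: (x^T *m y).
Proof.
rewrite /rayproj -scalemxAl -scalemxAr scalerA mulmxA -(mulmxA x^T) dotrE.
by rewrite mul_mx_scalar -scalemxAl scalerA.
Qed.

Lemma rayproj_ortho v : v != 0 -> orthoproj (rayproj v).
Proof.
move=> v0; split; first by rewrite /rayproj linearZ/= trmx_mul trmxK.
by rewrite rayproj_mul mulfVK ?dotr_neq0.
Qed.

Lemma rayproj_mul0 x y : dotr x y = 0 -> rayproj x *m rayproj y = 0.
Proof. by move=> xy0; rewrite rayproj_mul xy0 mulr0 scale0r. Qed.

Lemma rayprojZ k v : k != 0 -> rayproj (k *: v) = rayproj v.
Proof.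
move=> k0; rewrite /rayproj.
have -> : dotr (k *: v) (k *: v) = k * k * dotr v v.
  by rewrite /dotr [(_ *: _)^T]linearZ/= -scalemxAl -scalemxAr scalerA mxE.
rewrite [(_ *: _)^T]linearZ/= -scalemxAl -scalemxAr !scalerA; congr (_ *: _).
by rewrite invfM; move: (dotr v v)^-1 => c; field.
Qed.

Lemma orthoprojD (A B : 'M[R]_n) : orthoproj A -> orthoproj B -> A *m B = 0 ->
  orthoproj (A + B).
Proof.
move=> [At AA] [Bt BB] AB; have BA : B *m A = 0.
  by rewrite -At -Bt -trmx_mul AB trmx0.
split; first by rewrite linearD/= At Bt.
by rewrite mulmxDl !mulmxDr AA BB AB BA addr0 add0r.
Qed.

End ray.

(** The matrix with rows [x, y, z] has a right inverse, whose columns are the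
    rows rescaled; that it is also a left inverse is the claim. *)
Lemma rayproj_triad (R : realFieldType) (x y z : 'rV[R]_3) :
  x != 0 -> y != 0 -> z != 0 ->
  dotr x y = 0 -> dotr x z = 0 -> dotr y z = 0 ->
  rayproj x + rayproj y + rayproj z = 1%:M.
Proof.
move=> x0 y0 z0 xy xz yz.
pose r := [tuple x; y; z].
pose M := \matrix_(i < 3) r`_i.
pose N := \matrix_(i < 3) ((dotr r`_i r`_i)^-1 *: r`_i).
have MN : M *m N^T = 1%:M.
  apply/matrixP => i j; rewrite !mxE.
  have -> : \sum_k M i k * N^T k j = (dotr r`_j r`_j)^-1 * dotr r`_i r`_j.
    rewrite [dotr r`_i _]dotr_sum mulr_sumr; apply: eq_bigr => k _.
    by rewrite !mxE mulrCA.
  have [->|] := eqVneq i j.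
    by rewrite mulVf//; case: j => [[|[|[|]]]] //= _; exact: dotr_neq0.
  case: i j => [[|[|[|]]]] //= _ [[|[|[|]]]] //= _ _;
    rewrite ?xy ?xz ?yz ?mulr0//.
  - by rewrite dotrC xy mulr0.
  - by rewrite dotrC xz mulr0.
  - by rewrite dotrC yz mulr0.
rewrite -(mulmx1C MN); apply/matrixP => i j; rewrite /rayproj !mxE.
rewrite !big_ord_recl !big_ord0 !mxE /=.
by rewrite !addr0 !mulrA addrA.
Qed.

Section isometry.
Variables (R : realFieldType) (n k : nat) (S : 'M[R]_(k, n)).
Hypothesis S1 : S *m S^T = 1%:M.

Lemma dotr_isometry (x y : 'rV[R]_k) : dotr (x *m S) (y *m S) = dotr x y.
Proof. by rewrite /dotr trmx_mul -mulmxA (mulmxA S) S1 mul1mx. Qed.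

Lemma rayproj_isometry (x : 'rV[R]_k) : rayproj (x *m S) = S^T *m rayproj x *m S.
Proof.
by rewrite /rayproj dotr_isometry trmx_mul -scalemxAr -scalemxAl !mulmxA.
Qed.

Lemma isometry_neq0 (x : 'rV[R]_k) : x != 0 -> x *m S != 0.
Proof.
apply: contraNN => /eqP xS; by rewrite -(mulmx1 x) -S1 mulmxA xS mul0mx.
Qed.

End isometry.

Section additive.
Variables (R : rcfType) (d : Order.disp_t) (L : bDistrLatticeType d) (n : nat).
Variable mu : 'M[R]_n -> L.
Hypothesis mu_meet : forall A B, orthoproj A -> orthoproj B -> A *m B = 0 ->
  (mu A `&` mu B)%O = \bot%O.
Hypothesis mu_join : forall A B, orthoproj A -> orthoproj B -> A *m B = 0 ->
  mu (A + B) = (mu A `|` mu B)%O.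
Hypothesis n3 : (3 <= n)%N.

(** Three distinct indices starting with [i], here [i], [i + 1], [i + 2]
    modulo [n], embed R^3 isometrically with first axis going to the [i]-th
    one.  The orthogonal triples of the image all have the same sum of ray
    projections, so the join of the values of [mu] on such a triple does not
    depend on the triple. *)
Lemma additive_delta_bot (i : 'I_n) : mu (delta_mx i i) = \bot%O.
Proof.
have n0 : (0 < n)%N by exact: leq_trans n3.
pose f (a : 'I_3) : 'I_n := Ordinal (ltn_pmod (i + a) n0).
have finj : injective f.
  move=> a b /(congr1 val) /= /eqP; rewrite eqn_modDl.
  by rewrite !modn_small ?(leq_trans (ltn_ord _))// => /eqP /val_inj.
have f0 : f 0 = i by apply/val_inj; rewrite /= addn0 modn_small.
pose S : 'M[R]_(3, n) := \matrix_(a, b) (f a == b)%:R.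
have S1 : S *m S^T = 1%:M.
  apply/matrixP => a b; rewrite !mxE (bigD1 (f a))//= !mxE eqxx mul1r.
  rewrite (inj_eq finj) [b == a]eq_sym big1 ?addr0// => j.
  by rewrite !mxE eq_sym => /negPf->; rewrite mul0r.
have -> : delta_mx i i = rayproj (row3 1 0 0 *m S).
  have -> : row3 1 0 0 *m S = delta_mx 0 i.
    apply/rowP => j; rewrite !mxE (bigD1 0)//= big1 ?addr0 => [|[[|[|[|]]]] // p _].
    - by rewrite !mxE mul1r f0 eq_sym.
    - by rewrite !mxE mul0r.
    - by rewrite !mxE mul0r.
  rewrite /rayproj /dotr trmx_delta !mul_delta_mx !mxE eqxx invr1.
  by rewrite scale1r.
pose m x := mu (rayproj (x *m S)).
apply: (@kochen_specker_lattice _ _ _ m (mu (S^T *m S))).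
- by move=> k x k0; rewrite /m -scalemxAl rayprojZ.
- move=> x y x0 y0 xy; apply: mu_meet.
  + by apply/rayproj_ortho/isometry_neq0.
  + by apply/rayproj_ortho/isometry_neq0.
  + by rewrite rayproj_mul0// dotr_isometry.
- move=> x y z x0 y0 z0 xy xz yz.
  have P t : t != 0 -> orthoproj (rayproj (t *m S)).
    by move=> t0; apply/rayproj_ortho/isometry_neq0.
  have O s t : dotr s t = 0 -> rayproj (s *m S) *m rayproj (t *m S) = 0.
    by move=> st; rewrite rayproj_mul0// dotr_isometry.
  rewrite /m -mu_join; [|exact: P|exact: P|exact: O].
  rewrite -mu_join; last 1 first.
  + by rewrite mulmxDl !O// addr0.
  + rewrite !rayproj_isometry// -!mulmxDl -!mulmxDr rayproj_triad//.
    by rewrite mulmx1.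
  + by apply: orthoprojD; [exact: P|exact: P|exact: O].
  + exact: P.
Qed.

Lemma additive_bot : mu 1%:M = \bot%O.
Proof.
have diag_bot (s : seq 'I_n) : uniq s ->
    orthoproj (\sum_(i <- s) delta_mx i i : 'M[R]_n) /\
    mu (\sum_(i <- s) delta_mx i i) = \bot%O.
  elim: s => [_|i s IHs /= /andP[iNs /IHs[Ps mus]]].
    have P0 : orthoproj (0 : 'M[R]_n) by split; rewrite ?trmx0 ?mulmx0.
    by rewrite big_nil; split=> //; rewrite -(mu_meet P0 P0 (mulmx0 _ _)) meetxx.
  have Pi : orthoproj (delta_mx i i : 'M[R]_n).
    by split; rewrite ?trmx_delta ?mul_delta_mx.
  have is0 : delta_mx i i *m (\sum_(j <- s) delta_mx j j) = 0 :> 'M[R]_n.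
    rewrite mulmx_sumr big_seq big1// => j js; apply: mul_delta_mx_0.
    by apply: contraNneq iNs => ->.
  rewrite big_cons; split; first exact: orthoprojD.
  by rewrite mu_join// additive_delta_bot mus joinxx.
have [_] := diag_bot _ (index_enum_uniq 'I_n).
by rewrite -mx1_sum_delta.
Qed.

End additive.

(** * Frames and trivial locales *)

Section frame_hom.
Variables (L K : localeType locale_display) (f : frame_hom L K).

Lemma joins0 d (M : localeType d) : joins set0 = \bot%O :> M.
Proof.
have [_ lb] := joins_supremums (set0 : set M).
by apply/eqP; rewrite -lex0; apply: lb => x [].
Qed.

Lemma joins2 d (M : localeType d) (x y : M) :
  joins [set x; y] = (x `|` y)%O.
Proof.
have [ub lb] := joins_supremums [set x; y].
apply/eqP; rewrite eq_le leUx; apply/and3P; split.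
- by apply: lb => _ [->|->]; rewrite (leUl, leUr).
- by apply: ub; left.
- by apply: ub; right.
Qed.

Lemma frame_bot : f \bot%O = \bot%O.
Proof. by rewrite -joins0 frame_joins image_set0 joins0. Qed.

Lemma frame_join x y : f (x `|` y)%O = (f x `|` f y)%O.
Proof. by rewrite -joins2 frame_joins image_setU !image_set1 joins2. Qed.

End frame_hom.

Lemma locale_meetUl d (L : localeType d) :
  left_distributive (@Order.meet d L) (@Order.join d L).
Proof.
move=> x y z; rewrite meetC -joins2 meet_joinsr image_setU !image_set1 joins2.
by rewrite ![(z `&` _)%O]meetC.
Qed.

HB.instance Definition _ d (L : localeType d) :=
  Order.Lattice_Meet_isDistrLattice.Build d L (@locale_meetUl d L).

Section trivial.
Variable L : localeType locale_display.
Hypothesis top_bot : \top%O = \bot%O :> L.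

Lemma trivial_locale (x y : L) : x = y.
Proof.
have z (t : L) : t = \bot%O by apply/eqP; rewrite -lex0 -top_bot lex1.
by rewrite (z x) (z y).
Qed.

Definition trivial_frame_hom (K : localeType locale_display) : frame_hom K L.
Proof.
by refine (@FrameHom K L (fun=> \top%O) _ _ _) => *; exact: trivial_locale.
Defined.

Lemma trivial_initial : initial_object (L : Loc).
Proof.
move=> K; exists (trivial_frame_hom K); split=> // f _.
by apply: frame_hom_eq => x; exact: trivial_locale.
Qed.

End trivial.

Lemma opens_void_trivial : \top%O = \bot%O :> opens void.
Proof. by apply: opens_eq; apply/seteqP; split=> -[]. Qed.

Lemma initial_isomorphic (C : category) (a b : C) :
  initial_object a -> initial_object b -> isomorphic a b.
Proof.
move=> ia ib; have [f _] := ia b; have [g _] := ib a.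
exists f, g; split.
- by have [h [_ u]] := ia a; rewrite -(u (compm g f))// (u (idm a)).
- by have [h [_ u]] := ib b; rewrite -(u (compm f g))// (u (idm b)).
Qed.

(** * Projections and homomorphisms of C*-algebras *)

Section projections.
Variables (R : realType) (A : cstarType R).
Implicit Types p q : A.

Definition projection p := star p = p /\ p * p = p.

Lemma star0 : star (0 : A) = 0.
Proof. by have := starZ 0 (0 : A); rewrite scale0r rmorph0 scale0r. Qed.

Lemma star1 : star (1 : A) = 1.
Proof.
have s1x (x : A) : star 1 * x = x.
  have -> : star 1 * x = star (star x * 1) by rewrite [RHS]starM starK.
  by rewrite mulr1 starK.
by rewrite -[LHS]mulr1 s1x.
Qed.

Lemma starN p : star (- p) = - star p.
Proof. by apply: (addrI (star p)); rewrite -starD !subrr star0. Qed.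

Lemma projection_mulC p q : projection p -> projection q -> p * q = 0 -> q * p = 0.
Proof.
move=> [sp _] [sq _] pq.
have -> : q * p = star (p * q) by rewrite [RHS]starM sp sq.
by rewrite pq star0.
Qed.

Lemma projectionC p : projection p -> projection (1 - p).
Proof.
move=> [sp pp]; split; first by rewrite starD starN sp star1.
by rewrite mulrBl mul1r mulrBr mulr1 pp subrr subr0.
Qed.

Lemma projectionD p q : projection p -> projection q -> p * q = 0 ->
  projection (p + q).
Proof.
move=> Pp Pq pq; have qp := projection_mulC Pp Pq pq.
move: Pp Pq => [sp pp] [sq qq]; split; first by rewrite starD sp sq.
by rewrite mulrDl !mulrDr pp qq pq qp addr0 add0r.
Qed.

End projections.

Section star_hom_theory.
Variables (R : realType) (A B : cstarType R) (f : star_hom A B).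

Lemma star_homD x y : f (x + y) = f x + f y.
Proof. by have := star_fun_linear f 1 x y; rewrite !scale1r. Qed.

Lemma star_hom0 : f 0 = 0.
Proof. by apply: (addrI (f 0)); rewrite -star_homD !addr0. Qed.

Lemma star_homZ c x : f (c *: x) = c *: f x.
Proof. by have := star_fun_linear f c x 0; rewrite star_hom0 !addr0. Qed.

Lemma star_homB x y : f (x - y) = f x - f y.
Proof. by rewrite -scaleN1r star_homD star_homZ scaleN1r. Qed.

Lemma star_hom1 : f 1 = 1.
Proof. exact: (star_fun_monoid f).1. Qed.

Lemma star_homM x y : f (x * y) = f x * f y.
Proof. exact: (star_fun_monoid f).2. Qed.

Lemma star_hom_projection e : projection e -> projection (f e).
Proof.
move=> [se ee]; split; first by rewrite -star_fun_star se.
by rewrite -star_homM ee.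
Qed.

End star_hom_theory.

(** * The algebras C^k and partitions of unity *)

Section finite_algebra.
Variables (R : realType) (k : nat).

(** C^k with the norm of the diagonal matrices, from which the norm axioms
    are inherited. *)
Definition finite_algebra : Type := 'rV[R[i]]_k.

Implicit Types u v : 'rV[R[i]]_k.

HB.instance Definition _ := GRing.Lmodule.on finite_algebra.

Let norm v : R[i] := (opnorm (diag_mx v))%:C.

Lemma finite_normD u v : norm (u + v) <= norm u + norm v.
Proof. by rewrite /norm linearD -rmorphD lecR opnormD. Qed.

Lemma finite_normZ (c : R[i]) v : norm (c *: v) = `|c| * norm v.
Proof. by rewrite /norm linearZ opnormZ rmorphM. Qed.

Lemma diag_mx_entry v i : diag_mx v i i = v 0 i.
Proof. by rewrite mxE eqxx. Qed.

Lemma finite_norm_eq0 v : norm v = 0 -> v = 0.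
Proof.
move=> /complexI/opnorm_eq0 v0; apply/rowP => i.
by rewrite -diag_mx_entry v0 !mxE.
Qed.

HB.instance Definition _ := Lmodule_isNormed.Build R[i] finite_algebra
  finite_normD finite_normZ finite_norm_eq0.

Lemma finite_normE (v : finite_algebra) :
  `|v| = `|diag_mx v : matrix_algebra R k|.
Proof. by []. Qed.

(** A Cauchy filter converges as a filter of diagonal matrices, and its limit
    is diagonal because the entries are bounded by the norm. *)
Lemma finite_complete (F : set_system finite_algebra) :
  ProperFilter F -> cauchy F -> cvg F.
Proof.
move=> FF /(cauchyP F) Fc.
pose D (v : finite_algebra) : matrix_algebra R k := diag_mx v.
have DB (u v : finite_algebra) : `|D u - D v| = `|u - v|.
  rewrite finite_normE; congr `|_ : matrix_algebra R k|.
  exact/esym/(raddfB (@diag_mx R[i] k)).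
have /cauchy_cvg/cvg_ex[A DA] : cauchy (D @ F).
  apply/cauchyP => e e0; have [v Fv] := Fc e e0.
  exists (D v); rewrite /= nbhs_simpl /=; apply: filterS Fv => u.
  by rewrite -!ball_normE /= => uv; rewrite DB.
have Adiag i j : i != j -> A i j = 0.
  move=> ij; apply/eqP; rewrite -normr_le0; apply/ler_addgt0Pr => e e0.
  have := DA; move/cvgrPdist_lt/(_ _ e0).
  move=> /filter_ex[v]; rewrite matrix_normE add0r => /ltW; apply: le_trans.
  rewrite norm_normc lecR.
  have := opnorm_entry ((A : 'M_k) - diag_mx v) i j.
  by rewrite !mxE (negPf ij) subr0.
pose l : finite_algebra := \row_i A i i.
have Al : A = D l.
  apply/matrixP => i j; rewrite !mxE; case: eqVneq => [->//|].
  by move=> /Adiag.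
apply/cvg_ex; exists l; apply/cvgrPdist_lt => e e0.
have := DA; move/cvgrPdist_lt/(_ _ e0); rewrite Al; apply: filterS => v lv.
exact: eq_ind _ (fun t => t < e) lv _ (DB l v).
Qed.

HB.instance Definition _ :=
  Uniform_isComplete.Build finite_algebra finite_complete.

Let one : finite_algebra := const_mx 1.
Let mul u v : 'rV[R[i]]_k := \row_i (u 0 i * v 0 i).
Let fstar v : 'rV[R[i]]_k := \row_i (v 0 i)^*.

Let diag_mul u v : diag_mx (mul u v) = diag_mx u *m diag_mx v.
Proof.
by rewrite mulmx_diag; congr diag_mx.
Qed.

Let diag_star v : diag_mx (fstar v) = (diag_mx v) ^t*.
Proof.
apply/matrixP => i j; rewrite !mxE [j == i]eq_sym.
by case: eqP => [->|_] //; rewrite mulr0n rmorph0.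
Qed.

Let mulA : associative mul.
Proof. by move=> x y z; apply/rowP => i; rewrite !mxE mulrA. Qed.
Let mul1 : left_id one mul.
Proof. by move=> x; apply/rowP => i; rewrite !mxE mul1r. Qed.
Let mulr1 : right_id one mul.
Proof. by move=> x; apply/rowP => i; rewrite !mxE mulr1. Qed.
Let mulDl : left_distributive mul +%R.
Proof. by move=> x y z; apply/rowP => i; rewrite !mxE mulrDl. Qed.
Let mulDr : right_distributive mul +%R.
Proof. by move=> x y z; apply/rowP => i; rewrite !mxE mulrDr. Qed.
Let scaleAl (c : R[i]) x y : c *: mul x y = mul (c *: x) y.
Proof. by apply/rowP => i; rewrite !mxE mulrA. Qed.
Let scaleAr (c : R[i]) x y : c *: mul x y = mul x (c *: y).
Proof. by apply/rowP => i; rewrite !mxE mulrCA. Qed.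
Let fstarK : involutive fstar.
Proof. by move=> x; apply/rowP => i; rewrite !mxE conjCK. Qed.
Let fstarD : {morph fstar : x y / x + y}.
Proof. by move=> x y; apply/rowP => i; rewrite !mxE rmorphD. Qed.
Let fstarZ (c : R[i]) x : fstar (c *: x) = c^* *: fstar x.
Proof. by apply/rowP => i; rewrite !mxE rmorphM. Qed.
Let fstarM x y : fstar (mul x y) = mul (fstar y) (fstar x).
Proof. by apply/rowP => i; rewrite !mxE rmorphM mulrC. Qed.
Let normM x y : norm (mul x y) <= norm x * norm y.
Proof. by rewrite /norm diag_mul -rmorphM lecR opnormM. Qed.
Let cstar_id x : norm (mul (fstar x) x) = norm x ^+ 2.
Proof. by rewrite /norm diag_mul diag_star opnorm_cstar rmorphXn. Qed.

HB.instance Definition _ := isCstarAlgebra.Build R finite_algebra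
  mulA mul1 mulr1 mulDl mulDr scaleAl scaleAr fstarK fstarD fstarZ fstarM
  normM cstar_id.

Lemma finite_mulE (x y : (finite_algebra : cstarType R)) :
  x * y = (\row_i ((x : 'rV_k) 0 i * (y : 'rV_k) 0 i) : 'rV_k).
Proof. by []. Qed.

Lemma finite_algebraC : is_commutative (finite_algebra : Cstar R).
Proof.
by move=> x y; rewrite !finite_mulE; apply/rowP => i; rewrite !mxE mulrC.
Qed.

End finite_algebra.

Section partition.
Variables (R : realType) (A : cstarType R) (k : nat) (p : 'I_k -> A).
Hypothesis p_star : forall i, star (p i) = p i.
Hypothesis p_mul : forall i j, p i * p j = if i == j then p i else 0.
Hypothesis p_sum : \sum_i p i = 1.

Definition partition_fun (x : (finite_algebra R k : cstarType R)) : A :=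
  \sum_i (x : 'rV[R[i]]_k) 0 i *: p i.

Lemma partition_linear : linear partition_fun.
Proof.
move=> c x y; rewrite /partition_fun scaler_sumr -big_split /=.
by apply: eq_bigr => i _; rewrite !mxE scalerDl scalerA.
Qed.

Lemma partition_monoid : monoid_morphism partition_fun.
Proof.
split=> [|x y].
  rewrite /partition_fun -p_sum; apply: eq_bigr => i _.
  by rewrite !mxE scale1r.
rewrite /partition_fun mulr_suml; apply: eq_bigr => i _.
rewrite mulr_sumr (bigD1 i)//= big1 ?addr0 => [|j ji].
  rewrite -[RHS]cstar_scaleAl -cstar_scaleAr scalerA.
  by have := p_mul i i; rewrite eqxx /GRing.mul /= => ->; rewrite !mxE.
rewrite -[LHS]cstar_scaleAl -cstar_scaleAr.
have := p_mul i j; rewrite eq_sym (negPf ji) /GRing.mul /= => ->.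
by rewrite !scaler0.
Qed.

Lemma partition_star : {morph partition_fun : x / star x}.
Proof.
move=> x; rewrite /partition_fun.
rewrite (big_morph _ (@starD R A) (star0 A)); apply: eq_bigr => i _.
by rewrite starZ p_star !mxE.
Qed.

Definition partition_hom : star_hom (finite_algebra R k) A :=
  StarHom partition_linear partition_monoid partition_star.

End partition.

Section small_partitions.
Variables (R : realType) (A : cstarType R).

Lemma pair_hom (p : A) : projection p ->
  exists f : star_hom (finite_algebra R 2) A, forall x : 'rV[R[i]]_2,
    f x = x 0 0 *: p + x 0 1 *: (1 - p).
Proof.
move=> Pp; have Pq := projectionC Pp.
have pq : p * (1 - p) = 0 by rewrite mulrBr mulr1 Pp.2 subrr.
have qp := projection_mulC Pp Pq pq.
pose P (i : 'I_2) := [:: p; 1 - p]`_i.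
have P1 i : star (P i) = P i.
  by case: i => [[|[|]]] //= i0; [exact: Pp.1|exact: Pq.1].
have P2 i j : P i * P j = if i == j then P i else 0.
  case: i => [[|[|]]] //= i0; case: j => [[|[|]]] //= j0.
  - exact: Pp.2.
  - exact: Pq.2.
have P3 : \sum_i P i = 1 by rewrite !big_ord_recl big_ord0 /P /= addr0 subrKC.
exists (partition_hom P1 P2 P3) => x.
rewrite /= /partition_fun !big_ord_recl big_ord0 addr0.
by congr (_ + (x : 'rV_2) 0 _ *: _); apply/val_inj.
Qed.

Lemma triple_hom (p q : A) : projection p -> projection q -> p * q = 0 ->
  exists f : star_hom (finite_algebra R 3) A, forall x : 'rV[R[i]]_3,
    f x = x 0 0 *: p + x 0 1 *: q + x 0 2 *: (1 - (p + q)).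
Proof.
move=> Pp Pq pq; have Pr := projectionC (projectionD Pp Pq pq).
have qp := projection_mulC Pp Pq pq.
have pr : p * (1 - (p + q)) = 0 by rewrite mulrBr mulr1 mulrDr Pp.2 pq addr0 subrr.
have qr : q * (1 - (p + q)) = 0 by rewrite mulrBr mulr1 mulrDr Pq.2 qp add0r subrr.
have rp := projection_mulC Pp Pr pr.
have rq := projection_mulC Pq Pr qr.
pose P (i : 'I_3) := [:: p; q; 1 - (p + q)]`_i.
have P1 i : star (P i) = P i.
  by case: i => [[|[|[|]]]] //= i0; [exact: Pp.1|exact: Pq.1|exact: Pr.1].
have P2 i j : P i * P j = if i == j then P i else 0.
  case: i => [[|[|[|]]]] //= i0; case: j => [[|[|[|]]]] //= j0.
  - exact: Pp.2.
  - exact: Pq.2.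
  - exact: Pr.2.
have P3 : \sum_i P i = 1.
  by rewrite !big_ord_recl big_ord0 /P /= addr0 addrA subrKC.
exists (partition_hom P1 P2 P3) => x.
rewrite /= /partition_fun !big_ord_recl big_ord0 addr0 addrA.
by congr (_ + (x : 'rV_3) 0 _ *: _ + (x : 'rV_3) 0 _ *: _); apply/val_inj.
Qed.

End small_partitions.

(** * The measure on projections induced by the functor *)

Section nonvanishing.
Variables (R : realType).

Lemma character_eval_continuous (A : cstarType R) (a : A) :
  continuous (fun chi : character A => (chi : star_hom A _) a : complex_algebra R).
Proof.
move=> chi.
have chiF : Filter (nbhs chi) by exact: nbhs_filter.
have F : Filter (@character_eval R A @ chi) by exact: fmap_filter.
have : @character_eval R A @ chi --> character_eval chi.
  exact: initial_continuous.
by move/(pointwise_cvgP (F := @character_eval R A @ chi))/(_ a).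
Qed.

Lemma nonvanishing_open (A : cstarType R) (a : A) :
  [set chi : character A | (chi : star_hom A _) a != 0 :> R[i]] \in
    @open_pred (character A).
Proof.
apply/asboolP.
have o0 : open (~` [set (0 : complex_algebra R)]).
  apply/closed_openC/accessible_closed_set1/hausdorff_accessible.
  exact: norm_hausdorff.
have /continuousP/(_ _ o0) := @character_eval_continuous A a.
congr open; apply/seteqP; split=> chi /=.
  by move/eqP.
by move=> /eqP.
Qed.

(** For a projection [a] this is the clopen set on which it takes the value
    one. *)
Definition nonvanishing (A : cstarType R) (a : A) : opens (character A) :=
  Opens (nonvanishing_open a).

Lemma nonvanishing1 (A : cstarType R) : nonvanishing (1 : A) = \top%O.
Proof.
apply: opens_eq; apply/seteqP; split=> // chi _ /=.
by rewrite (star_fun_monoid (chi : star_hom A _)).1 oner_eq0.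
Qed.

Lemma character_mul0 (A : cstarType R) (chi : star_hom A (complex_algebra R))
    (a b : A) : a * b = 0 -> chi a = 0 \/ chi b = 0.
Proof.
move=> ab; have /eqP : (chi a : R[i]) * chi b = 0.
  by rewrite -[LHS](star_homM chi) ab star_hom0.
by rewrite mulf_eq0 => /orP[]/eqP; [left|right].
Qed.

Lemma nonvanishing_meet (A : cstarType R) (a b : A) : a * b = 0 ->
  (nonvanishing a `&` nonvanishing b)%O = \bot%O.
Proof.
move=> ab; apply: opens_eq; apply/seteqP; split=> // chi [/= a0 b0].
have [/eqP|/eqP] := character_mul0 chi ab.
  by rewrite (negPf a0).
by rewrite (negPf b0).
Qed.

Lemma nonvanishing_join (A : cstarType R) (a b : A) : a * b = 0 ->
  nonvanishing (a + b) = (nonvanishing a `|` nonvanishing b)%O.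
Proof.
move=> ab; apply: opens_eq; apply/seteqP; split=> chi /=.
  rewrite star_homD; have [a0|a0 _] := eqVneq (chi a) 0; last by left.
  by rewrite a0 add0r; right.
rewrite star_homD; have [a0|b0] := character_mul0 chi ab.
  by rewrite a0 add0r => -[/eqP|].
by rewrite b0 addr0 => -[|/eqP].
Qed.

End nonvanishing.

Section value.
Variables (R : realType) (G : functor (opposite (Cstar R)) Loc).
Hypothesis G_Spec : naturally_isomorphic
  (comp_functor G (opposite_functor (inclusion (@is_commutative R)))) (Spec R).

Definition finite_cC k : cCstar R :=
  exist (@is_commutative R) _ (@finite_algebraC R k).

(** The form in which the hypothesis on [G] is used: a homomorphism from C^k
    to [A] transports opens of the spectrum of C^k to [G A], compatibly with
    homomorphisms between these finite-dimensional commutative algebras. *)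
Lemma exists_natural_frame_homs (A : cstarType R) :
  exists val : forall k, star_hom (finite_algebra R k) A ->
    frame_hom (opens (character (finite_algebra R k))) (G A),
  forall k l (f : star_hom (finite_algebra R l) A)
    (g : star_hom (finite_algebra R k) (finite_algebra R l)) U,
    val k (star_comp f g) U = val l f (Spec_map g U).
Proof.
have [eta [_ eta_nat]] := G_Spec.
pose val k (f : star_hom (finite_algebra R k) A) :
    frame_hom (opens (character (finite_algebra R k))) (G A) :=
  frame_comp (functor_map G (f : @mor (opposite (Cstar R)) A (finite_algebra R k)))
    (eta (finite_cC k)).
exists val => k l f g U.
have Gfg := @functor_mapM _ _ G A (finite_algebra R l) (finite_algebra R k)
  (g : @mor (opposite (Cstar R)) (finite_algebra R l) (finite_algebra R k)) f.
rewrite /= in Gfg.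
have nat_g := @eta_nat (finite_cC l) (finite_cC k) g.
move: nat_g => /(congr1 (fun h : frame_hom _ _ => frame_fun h U)) /= nat_g.
by rewrite /val /= Gfg /= nat_g.
Qed.

(** The element [mu p] is read off on C^2, but by naturality ([muE]) it can be
    computed from any homomorphism out of C^l with [p] in its image.
    Orthogonal [p] and [q] lie in the image of one homomorphism out of C^3,
    so additivity reduces to the corresponding facts about opens of a
    spectrum. *)
Lemma exists_measure (A : cstarType R) :
  exists mu : A -> G A, [/\ mu 1 = \top%O,
    forall p q, projection p -> projection q -> p * q = 0 ->
      (mu p `&` mu q)%O = \bot%O &
    forall p q, projection p -> projection q -> p * q = 0 ->
      mu (p + q) = (mu p `|` mu q)%O].
Proof.
have [val val_comp] := exists_natural_frame_homs A.
pose e0 : (finite_algebra R 2 : cstarType R) := (delta_mx 0 0 : 'rV_2).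
pose mu (p : A) : G A :=
  if pselect (projection p) is left Pp
  then val 2%N (sval (cid (pair_hom Pp))) (nonvanishing e0) else \bot%O.
have muE l (f : star_hom (finite_algebra R l) A) e : projection e ->
    mu (f e) = val l f (nonvanishing e).
  move=> Pe; rewrite /mu; case: pselect => [Pfe|]; last first.
    by move=> nP; exfalso; apply: nP; exact: star_hom_projection.
  case: cid => h hE /=.
  have [g gE] := pair_hom Pe.
  have -> : h = star_comp f g.
    apply: star_hom_eq => x; rewrite hE /= gE.
    by rewrite star_homD !star_homZ star_homB star_hom1.
  have ge0 : g e0 = e by rewrite gE !mxE /= scale1r scale0r addr0.
  rewrite val_comp; congr (val l f _); apply: opens_eq.
  by rewrite /= -[in RHS]ge0.
have pairing p q : projection p -> projection q -> p * q = 0 ->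
  exists (f : star_hom (finite_algebra R 3) A)
      (a b : (finite_algebra R 3 : cstarType R)),
    [/\ projection a, projection b & a * b = 0] /\ f a = p /\ f b = q.
  move=> Pp Pq pq; have [f fE] := triple_hom Pp Pq pq.
  exists f, (delta_mx 0 0 : 'rV_3), (delta_mx 0 1 : 'rV_3); split.
    split; first split.
    - by apply/rowP => i; rewrite !mxE rmorph_nat.
    - by rewrite finite_mulE; apply/rowP => i; rewrite !mxE -natrM mulnb andbb.
    - split; first by apply/rowP => i; rewrite !mxE rmorph_nat.
      by rewrite finite_mulE; apply/rowP => i; rewrite !mxE -natrM mulnb andbb.
    - rewrite finite_mulE; apply/rowP => i; rewrite !mxE -natrM mulnb /=.
      by case: i => [[|[|[]]]].
  by split; rewrite fE !mxE /= ?(scale1r, scale0r, addr0, add0r).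
exists mu; split.
- have P1 (B : cstarType R) : projection (1 : B).
    by split; rewrite ?star1 ?mulr1.
  have [f _] := pair_hom (P1 A).
  by rewrite -(star_hom1 f) muE// nonvanishing1 frame_top.
- move=> p q Pp Pq pq; have [f [a [b [[Pa Pb ab] [<- <-]]]]] := pairing p q Pp Pq pq.
  by rewrite !muE// -frame_meet nonvanishing_meet// frame_bot.
- move=> p q Pp Pq pq; have [f [a [b [[Pa Pb ab] [<- <-]]]]] := pairing p q Pp Pq pq.
  rewrite -star_homD !muE//; last exact: projectionD.
  by rewrite nonvanishing_join// frame_join.
Qed.

End value.

Section real_matrices.
Variables (R : realType) (n : nat).

(** The rays of the Kochen-Specker argument are real, so the projections that
    it involves are the images of real matrices. *)
Definition complexify (A : 'M[R]_n) : (matrix_algebra R n : cstarType R) :=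
  map_mx (real_complex R) A.

Lemma complexify1 : complexify 1%:M = 1.
Proof. exact: map_mx1. Qed.

Lemma complexifyD A B : complexify (A + B) = complexify A + complexify B.
Proof. exact: map_mxD. Qed.

Lemma complexifyM A B : complexify (A *m B) = complexify A * complexify B.
Proof. exact: map_mxM. Qed.

Lemma complexify_mul0 A B : A *m B = 0 -> complexify A * complexify B = 0.
Proof. by move=> AB; rewrite -complexifyM AB; exact: map_mx0. Qed.

Lemma complexify_projection A : orthoproj A -> projection (complexify A).
Proof.
move=> [At AA]; split.
  apply/matrixP => i j; rewrite -[in RHS]At !mxE /=.
  exact: conjc_real.
by rewrite -complexifyM AA.
Qed.

End real_matrices.

Local Close Scope ring_scope.

Theorem corollary5p1 (R : realType) (n : nat) (n_ge3 : 3 <= n)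
    (G : functor (opposite (Cstar R)) Loc)
    (G_Spec : naturally_isomorphic
       (comp_functor G (opposite_functor (inclusion (@is_commutative R))))
       (Spec R)) :
  initial_object (G (matrix_algebra R n)) /\
  isomorphic (G (matrix_algebra R n)) (opens void).
Proof.
have [mu [mu1 mu_meet mu_join]] := exists_measure G_Spec (matrix_algebra R n).
have triv : \top%O = \bot%O :> G (matrix_algebra R n).
  rewrite -mu1 -complexify1.
  apply: (@additive_bot _ _ (G (matrix_algebra R n)) n (mu \o @complexify R n)) => //.
  - move=> A B PA PB AB; apply: mu_meet; first 2 last.
    + exact: complexify_mul0.
    + exact: complexify_projection.
    + exact: complexify_projection.
  - move=> A B PA PB AB; rewrite /= complexifyD; apply: mu_join; first 2 last.
    + exact: complexify_mul0.
    + exact: complexify_projection.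
    + exact: complexify_projection.
split; first exact: trivial_initial.
apply: initial_isomorphic; first exact: trivial_initial.
exact/trivial_initial/opens_void_trivial.
Qed.
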